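(* Let $G$ be a proper interval graph. Then $\chi_{pcf}(G)\leq\omega(G)+1$. Moreover, $\chi_{pcf}(G)=\omega(G)+1$ if and only if $G$ is a special proper interval graph.
   Context: All graphs are finite, simple, connected and undirected. $N(v)$ is the open neighborhood of $v$, $[k]=\{1,\dots,k\}$, and $\omega(G)$ is the maximum size of a clique of $G$. A proper conflict-free (PCF) $k$-coloring of a graph $G$ is a proper coloring $f:V(G)\to[k]$ such that for every non-isolated vertex $v$ there is a color (depending on $v$) that appears on exactly one vertex of $N(v)$. $\chi_{pcf}(G)$ is the least $k$ such that $G$ admits a PCF $k$-coloring. $G$ is a proper interval graph if it is the intersection graph of a family of intervals on the real line none of which properly contains another. A proper interval graph $G$ is special if there exists a vertex $v\in V(G)$ contained in two distinct maximum cliques $C_1$ and $C_2$ (cliques of size $\omega(G)$) such that $C_1\cap C_2=\{v\}$. *)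

(* Defs.v *)
(* MathComp + MathComp-Analysis *)
From HB Require Import structures.
From mathcomp Require Import all_boot all_order all_algebra.
From mathcomp Require Import all_classical all_reals all_analysis.
Set Implicit Arguments.
Unset Strict Implicit.
Unset Printing Implicit Defensive.

Record sgraph := SGraph {
  vertex :> finType;
  adj : rel vertex;
  adj_sym : symmetric adj;
  adj_irrefl : irreflexive adj }.

Definition nbh (G : sgraph) (v : G) : {set G} := [set u | adj v u].

(* Vacuously true of the graph without vertices. *)
Definition connected_graph (G : sgraph) : Prop :=
  forall x y : G, connect (@adj G) x y.

Definition clique (G : sgraph) (C : {set G}) : bool :=
  [forall x in C, forall y in C, (x != y) ==> adj x y].

Definition omega (G : sgraph) : nat := \max_(C : {set G} | clique C) #|C|.

Definition maximum_clique (G : sgraph) (C : {set G}) : bool :=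
  clique C && (#|C| == omega G).

(* The set of colors [k] = {1, ..., k} is represented by 'I_k. *)
Definition proper_coloring (G : sgraph) (k : nat) (f : {ffun G -> 'I_k}) : bool :=
  [forall x, forall y, adj x y ==> (f x != f y)].

Definition conflict_free (G : sgraph) (k : nat) (f : {ffun G -> 'I_k}) : bool :=
  [forall v, (nbh v != finset.set0) ==>
     [exists c : 'I_k, #|[set u in nbh v | f u == c]| == 1]].

Definition pcf_colorable (G : sgraph) (k : nat) : bool :=
  [exists f : {ffun G -> 'I_k}, proper_coloring f && conflict_free f].

(* Giving all vertices different colors is a PCF coloring, so that the minimum
   defining chi_pcf exists. *)
Lemma pcf_colorable_card (G : sgraph) : pcf_colorable G #|G|.
Proof.
apply/existsP; exists [ffun x => enum_rank x]; apply/andP; split.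
  apply/forallP => x; apply/forallP => y; apply/implyP => exy.
  rewrite !ffunE (inj_eq enum_rank_inj); apply: contraTneq exy => ->.
  by rewrite adj_irrefl.
apply/forallP => v; apply/implyP => /set0Pn[w vw].
apply/existsP; exists (enum_rank w); apply/cards1P; exists w.
apply/setP => u; rewrite !inE ffunE (inj_eq enum_rank_inj).
by case: eqVneq => [->|]; rewrite ?andbF // andbT; move: vw; rewrite inE.
Qed.

Definition chi_pcf (G : sgraph) : nat :=
  ex_minn (ex_intro (fun k => pcf_colorable G k) #|G| (pcf_colorable_card G)).

Local Open Scope classical_set_scope.

(* The intervals may be open, closed, half-open, degenerate or unbounded, and
   several vertices may have the same interval. *)
Definition proper_interval_graph (R : realType) (G : sgraph) : Prop :=
  exists I : G -> set R,
    [/\ forall x, is_interval (I x) /\ I x !=set0,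
        forall x y, ~ (I x `<` I y) &
        forall x y, adj x y <-> x <> y /\ I x `&` I y !=set0].

Local Close Scope classical_set_scope.

Definition special_proper_interval_graph (R : realType) (G : sgraph) : Prop :=
  proper_interval_graph R G /\
  exists (v : G) (C1 C2 : {set G}),
    [/\ maximum_clique C1 /\ maximum_clique C2, C1 <> C2,
        v \in C1 /\ v \in C2 & C1 :&: C2 = [set v]%SET].

(* Main.v *)
Require Import Defs.
From mathcomp Require Import all_boot all_order all_algebra.
From mathcomp Require Import all_classical all_reals all_analysis.
From mathcomp Require Import zify.
Import Order.TTheory.
Set Implicit Arguments.
Unset Strict Implicit.
Unset Printing Implicit Defensive.

(** List the vertices by increasing right end: every closed neighbourhood is
    then a block of consecutive positions, and adjacent vertices are at distance
    less than [omega G].  Color positions cyclically with [k >= omega G] colors.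
    The color of the successor of [v] recurs in the neighbourhood of [v] only at
    distance [k - 1] to the left of [v], and symmetrically for the predecessor.
    For [k = omega G + 1] this is too far; for [k = omega G] both fail only if
    [v] is the last vertex of a maximum clique and the first of another one.
    Conversely, if two maximum cliques meet in [v] only, then with [omega G]
    colors each color other than that of [v] occurs on both of them. *)

(** The first two clauses make [p] a numbering of the vertices by consecutive integers. The last two
    are the umbrella property: an edge joins each of its ends to every vertex in between. *)
Definition umbrella_order {G : sgraph} (p : G -> nat) : Prop :=
  [/\ injective p,
      forall x y k, p x <= k <= p y -> exists z, p z = k,
      forall x y z, p x < p y <= p z -> adj x z -> adj x y &
      forall x y z, p x <= p y < p z -> adj x z -> adj y z].

(** * Interval representations and umbrella orders *)

Section IntervalOrder.
Context {R : realType}.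
Implicit Types A B : set R.
Local Open Scope classical_set_scope.
Local Open Scope ring_scope.

(** Inclusion of these down-sets compares right ends uniformly for open, closed and unbounded
    intervals. *)
Definition lower_closure A : set R := [set a | exists2 b, A b & a <= b].
Definition upper_closure A : set R := [set a | exists2 b, A b & b <= a].

Lemma lower_closure_total A B :
  lower_closure A `<=` lower_closure B \/ lower_closure B `<=` lower_closure A.
Proof.
have [|/existsNP[a /not_implyP[[a' Aa' aa'] nBa]]] :=
  pselect (lower_closure A `<=` lower_closure B); first by left.
right=> b [b' Bb' bb']; exists a' => //; rewrite (le_trans bb')//.
case: (leP b' a') => // /ltW a'b'; exfalso; apply: nBa.
by exists b' => //; exact: le_trans aa' a'b'.
Qed.

Lemma upper_closure_total A B :
  upper_closure A `<=` upper_closure B \/ upper_closure B `<=` upper_closure A.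
Proof.
have [|/existsNP[a /not_implyP[[a' Aa' aa'] nBa]]] :=
  pselect (upper_closure A `<=` upper_closure B); first by left.
right=> b [b' Bb' bb']; exists a' => //; rewrite (le_trans _ bb')//.
case: (leP a' b') => // /ltW a'b'; exfalso; apply: nBa.
by exists b' => //; exact: le_trans a'b' aa'.
Qed.

Lemma interval_closureI A :
  is_interval A -> A = lower_closure A `&` upper_closure A.
Proof.
move=> iA; apply/seteqP; split=> [a Aa|a [[b Ab ab] [c Ac ca]]].
  by split; exists a.
by apply: (iA c b) => //; rewrite ca ab.
Qed.

(** If the left ends were ordered the other way, [A] would lie inside [B], and properness would
    force [A = B]. *)
Lemma proper_interval_upper A B : is_interval A -> is_interval B ->
  ~ (A `<` B) -> ~ (B `<` A) -> lower_closure A `<=` lower_closure B ->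
  upper_closure B `<=` upper_closure A.
Proof.
move=> iA iB nAB nBA lAB; have [uAB|//] := upper_closure_total A B.
have sAB : A `<=` B.
  by rewrite (interval_closureI iA) (interval_closureI iB); exact: setISS.
suff -> : A = B by [].
apply/seteqP; split=> //; apply: contrapT => sBA.
by apply: nAB; split.
Qed.

Lemma proper_interval_umbrella (G : sgraph) :
  proper_interval_graph R G -> exists p : G -> nat, umbrella_order p.
Proof.
move=> [I [iI nI adjI]].
pose leI : rel G := fun x y => `[< lower_closure (I x) `<=` lower_closure (I y) >].
have leI_total : total leI.
  by move=> x y; apply/orP; have [?|?] := lower_closure_total (I x) (I y);
    [left|right]; apply/asboolP.
have leI_trans : transitive leI.
  move=> y x z /asboolP xy /asboolP yz; apply/asboolP.
  exact: subset_trans xy yz.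
have leI_refl : reflexive leI by move=> x; apply/asboolP.
(* [leI] is only a preorder; sorting breaks ties between intervals with the same right end. *)
pose s := sort leI (enum G).
have mem_s x : x \in s by rewrite mem_sort mem_enum.
have s_uniq : uniq s by rewrite sort_uniq enum_uniq.
pose p x := index x s.
have p_le x y : (p x <= p y)%N -> leI x y.
  apply: (sorted_leq_index leI_trans leI_refl) => //.
  exact: sort_sorted.
(* The point [a] does not pass the right end of [I y] because it lies in [I x], nor its left end
   because it lies in [I z]. *)
have helly x y z a : (p x <= p y)%N -> (p y <= p z)%N ->
    I x a -> I z a -> I y a.
  move=> /p_le/asboolP xy /p_le/asboolP yz xa za.
  have [iy _] := iI y; have [iz _] := iI z.
  rewrite (interval_closureI iy); split; first by apply: xy; exists a.
  by apply: (proper_interval_upper iy iz (nI _ _) (nI _ _) yz); exists a.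
exists p; split.
- by move=> x y pxy; rewrite -(nth_index x (mem_s x)) -/(p x) pxy nth_index.
- move=> x y k /andP[_ ky]; exists (nth x s k).
  by rewrite /p index_uniq// (leq_ltn_trans ky)// index_mem.
- move=> x y z /andP[xy yz] /adjI[_ [a [xa za]]]; apply/adjI; split.
    by move=> exy; rewrite exy ltnn in xy.
  by exists a; split=> //; exact: (helly x y z a (ltnW xy) yz).
- move=> x y z /andP[xy yz] /adjI[_ [a [xa za]]]; apply/adjI; split.
    by move=> eyz; rewrite eyz ltnn in yz.
  by exists a; split=> //; exact: (helly x y z a xy (ltnW yz)).
Qed.

End IntervalOrder.

Lemma clique_leq_omega (G : sgraph) (C : {set G}) : clique C -> #|C| <= omega G.
Proof. by move=> cC; rewrite /omega (bigD1 C)//= leq_maxl. Qed.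

Lemma omega_gt0 (G : sgraph) (x : G) : 0 < omega G.
Proof.
rewrite -(cards1 x); apply: clique_leq_omega.
apply/forall_inP => y /set1P ->; apply/forall_inP => z /set1P ->.
by rewrite eqxx.
Qed.

Lemma pcf_colorable_chi (G : sgraph) : pcf_colorable G (chi_pcf G).
Proof. by rewrite /chi_pcf; case: ex_minnP. Qed.

Lemma chi_pcf_leq (G : sgraph) k : pcf_colorable G k -> chi_pcf G <= k.
Proof. by rewrite /chi_pcf; case: ex_minnP => m _; apply. Qed.

Lemma eq_mod_close k a b : a = b %[mod k] -> a <= b -> b < a + k.*2 ->
  a = b \/ b = a + k.
Proof.
move=> /eqP; rewrite eq_sym => eab ab; move: eab.
rewrite eqn_mod_dvd// => /dvdnP[[|[|q]] qE]; [left|right|]; nia.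
Qed.

(** * Cliques as blocks of positions *)

Section Umbrella.
Context {G : sgraph} (p : G -> nat).
Hypothesis hp : umbrella_order p.

Definition block (a b : nat) : {set G} := [set z | a <= p z <= b].

(** For [u] before [v] in the block, the umbrella property shrinks the edge from [x] to [y] first to
    [u], [y] and then to [u], [v]. *)
Lemma clique_block x y : p x <= p y -> (x != y -> adj x y) ->
  clique (block (p x) (p y)).
Proof.
have [inj_p _ adjl adjr] := hp => pxy axy.
have ordered u v : u \in block (p x) (p y) -> v \in block (p x) (p y) ->
    p u < p v -> adj u v.
  rewrite !inE => /andP[xu uy] /andP[xv vy] uv.
  have nxy : x != y.
    by apply/eqP => exy; rewrite exy in xu; lia.
  apply: (adjl u v y); first by rewrite uv.
  apply: (adjr x u y); last exact: axy.
  by rewrite xu (leq_trans uv).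
apply/forall_inP => u ub; apply/forall_inP => v vb; apply/implyP => nuv.
case: (ltngtP (p u) (p v)) => [uv|vu|/inj_p uv].
- exact: ordered.
- by rewrite adj_sym; exact: ordered.
- by rewrite uv eqxx in nuv.
Qed.

Lemma card_block x y : p x <= p y -> (p y).+1 - p x <= #|block (p x) (p y)|.
Proof.
have [_ conv _ _] := hp => pxy.
rewrite cardE -(size_map p) -[leqLHS](size_iota (p x)).
apply: uniq_leq_size (iota_uniq _ _) _ => k; rewrite mem_iota => kxy.
have [z pz] := conv x y k ltac:(lia).
by apply/mapP; exists z => //; rewrite mem_enum inE pz; lia.
Qed.

Lemma adj_close x y : adj x y -> p y < p x + omega G.
Proof.
move=> xy; case: (leqP (p x) (p y)) => pxy; last first.
  by have := omega_gt0 x; lia.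
have := leq_trans (card_block pxy) (clique_leq_omega (clique_block pxy (fun=> xy))).
lia.
Qed.

Lemma maximum_block x y : adj x y -> p y = (p x + omega G).-1 ->
  maximum_clique (block (p x) (p y)).
Proof.
move=> xy pyE; have w0 := omega_gt0 x; have pxy : p x <= p y by lia.
have cB := clique_block pxy (fun=> xy).
rewrite /maximum_clique cB eqn_leq clique_leq_omega//=.
by apply: leq_trans (card_block pxy); lia.
Qed.

(** * Cyclic colorings *)

Section Coloring.
Variable k : nat.
Hypothesis omega_k : omega G <= k.+1.

(** There are [k.+1] colors, so the critical distance from [v] in what follows is [k]. *)
Definition cyclic_coloring : {ffun G -> 'I_k.+1} := [ffun x => inord (p x %% k.+1)].

Lemma cyclic_coloringE x y :
  (cyclic_coloring x == cyclic_coloring y) = (p x == p y %[mod k.+1]).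
Proof. by rewrite !ffunE -val_eqE /= !inordK ?ltn_mod. Qed.

Lemma proper_cyclic_coloring : proper_coloring cyclic_coloring.
Proof.
have [inj_p _ _ _] := hp.
apply/forallP => x; apply/forallP => y; apply/implyP => xy.
rewrite cyclic_coloringE; apply/eqP => exy.
have yx : adj y x by rewrite adj_sym.
have [dxy dyx] := (adj_close xy, adj_close yx).
have pxy : p x = p y.
  case: (leqP (p x) (p y)) => [|/ltnW] le.
    by case: (eq_mod_close exy le); lia.
  by case: (eq_mod_close (esym exy) le); lia.
by rewrite (inj_p _ _ pxy) adj_irrefl in xy.
Qed.

(** Take [z] right after [v]. A neighbor of its color other than [z] would be at [p v + k + 2], too
    far, or at [p v - k], excluded by assumption. *)
Lemma unique_succ v u : adj v u -> p v < p u ->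
  (forall w, adj v w -> p w + k <> p v) ->
  exists2 z, adj v z &
    forall w, adj v w -> cyclic_coloring w = cyclic_coloring z -> w = z.
Proof.
have [inj_p conv adjl _] := hp => vu pvu far.
have [z pz] := conv v u (p v).+1 ltac:(lia).
exists z => [|w vw /eqP]; first by apply: (adjl v z u) => //; rewrite pz leqnn.
rewrite cyclic_coloringE => /eqP ewz; apply: inj_p.
have wv : adj w v by rewrite adj_sym.
have [dvw dwv] := (adj_close vw, adj_close wv).
have farw := far w vw.
case: (leqP (p w) (p z)) => [|/ltnW] le.
  by case: (eq_mod_close ewz le); lia.
by case: (eq_mod_close (esym ewz) le); lia.
Qed.

Lemma unique_pred v u : adj v u -> p u < p v ->
  (forall w, adj v w -> p w <> p v + k) ->
  exists2 z, adj v z &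
    forall w, adj v w -> cyclic_coloring w = cyclic_coloring z -> w = z.
Proof.
have [inj_p conv _ adjr] := hp => vu pvu far.
have [z pz] := conv u v (p v).-1 ltac:(lia).
exists z => [|w vw /eqP].
  by rewrite adj_sym; apply: (adjr u z v); [lia|rewrite adj_sym].
rewrite cyclic_coloringE => /eqP ewz; apply: inj_p.
have wv : adj w v by rewrite adj_sym.
have [dvw dwv] := (adj_close vw, adj_close wv).
have farw := far w vw.
case: (leqP (p w) (p z)) => [|/ltnW] le.
  by case: (eq_mod_close ewz le); lia.
by case: (eq_mod_close (esym ewz) le); lia.
Qed.

Lemma pcf_colorable_cyclic :
  (forall u v w, adj u v -> adj v w -> p u + k = p v -> p w = p v + k -> False) ->
  pcf_colorable G k.+1.
Proof.
have [inj_p _ _ _] := hp => nspecial.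
apply/existsP; exists cyclic_coloring; rewrite proper_cyclic_coloring /=.
apply/forallP => v; apply/implyP => /set0Pn[u0]; rewrite inE => vu0.
suff [z vz zU] : exists2 z, adj v z &
    forall w, adj v w -> cyclic_coloring w = cyclic_coloring z -> w = z.
  apply/existsP; exists (cyclic_coloring z); apply/cards1P; exists z.
  apply/setP => w; rewrite !inE; apply/andP/eqP => [[vw /eqP]|->].
    exact: zU.
  by rewrite vz eqxx.
(* The successor works if it is a neighbor and nothing adjacent lies [k] to the left. Otherwise the
   predecessor works: either [v] has no neighbor to its right, or [l] exists and the hypothesis
   forbids one at distance [k]. *)
have [[l vl lk]|nl] := pselect (exists2 l, adj v l & p l + k = p v); last first.
  have [[r vr ltr]|nr] := pselect (exists2 r, adj v r & p v < p r).
    by apply: (unique_succ vr ltr) => w vw wk; apply: nl; exists w.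
  apply: (unique_pred vu0) => [|w vw wk].
    rewrite ltnNge leq_eqVlt; apply/orP => -[/eqP/inj_p vE|ltv].
      by rewrite vE adj_irrefl in vu0.
    by apply: nr; exists u0.
  apply: nr; exists w => //; rewrite ltn_neqAle wk leq_addr andbT.
  rewrite -wk; apply/eqP => /inj_p vE.
  by rewrite vE adj_irrefl in vw.
(* [l] is strictly to the left: for [k = 0] it would be [v] itself. *)
apply: (unique_pred vl) => [|w vw].
  rewrite ltn_neqAle -lk leq_addr andbT lk; apply/eqP => /inj_p vE.
  by rewrite vE adj_irrefl in vl.
by apply: nspecial vw lk; rewrite adj_sym.
Qed.

End Coloring.

Lemma pcf_colorable_omegaS : pcf_colorable G (omega G).+1.
Proof.
apply: pcf_colorable_cyclic => // u v w uv _.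
by have := adj_close uv; lia.
Qed.

End Umbrella.

(** * Special graphs and [omega G] colors *)

Lemma special_of_not_colorable (R : realType) (G : sgraph) :
  proper_interval_graph R G -> ~~ pcf_colorable G (omega G) ->
  special_proper_interval_graph R G.
Proof.
move=> hG ncol; split=> //; have [p hp] := proper_interval_umbrella hG.
(* Clique number 0 means no vertices; the cyclic coloring requires at least one color. *)
case wE: (omega G) => [|k].
  have G0 : #|G| = 0.
    by apply: eq_card0 => x; have := omega_gt0 x; rewrite wE.
  by case/negP: ncol; rewrite wE -G0; exact: pcf_colorable_card.
apply: contrapT => nspecial; case/negP: ncol; rewrite wE.
apply: (pcf_colorable_cyclic hp) => [|u v w uv vw ukv vkw]; first by rewrite wE.
have [inj_p _ _ _] := hp.
apply: nspecial; exists v, (block p (p u) (p v)), (block p (p v) (p w)).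
have CI : block p (p u) (p v) :&: block p (p v) (p w) = [set v]%SET.
  apply/setP => z; rewrite !inE; apply/idP/eqP => [?|->].
    by apply: inj_p; lia.
  by lia.
split=> //; first by split; apply: maximum_block => //; lia.
- move=> eC; have : u \in block p (p u) (p v) :&: block p (p v) (p w).
    by rewrite -eC finset.setIid inE leqnn -ukv leq_addr.
  rewrite CI inE => /eqP euv.
  by rewrite euv adj_irrefl in uv.
- by rewrite !inE; lia.
Qed.

(** Pigeonhole: a proper coloring is injective on a clique. *)
Lemma proper_coloring_clique_onto (G : sgraph) k (f : {ffun G -> 'I_k})
    (C : {set G}) : proper_coloring f -> clique C -> k <= #|C| ->
  forall c, exists2 x, x \in C & f x = c.
Proof.
move=> fP cC kC c.
have f_inj : {in C &, injective f}.
  move=> x y xC yC; apply: contra_eq => nxy.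
  have xy : adj x y.
    by move/forall_inP: cC => /(_ x xC)/forall_inP/(_ y yC)/implyP; apply.
  by move/forallP: fP => /(_ x)/forallP/(_ y)/implyP; apply.
have fC : f @: C = [set: 'I_k]%SET.
  by apply/eqP; rewrite eqEcard finset.subsetT cardsT card_ord card_in_imset.
have : c \in f @: C by rewrite fC finset.in_setT.
by case/imsetP => x xC ->; exists x.
Qed.

Lemma special_chi_pcf_gt (R : realType) (G : sgraph) :
  special_proper_interval_graph R G -> omega G < chi_pcf G.
Proof.
move=> [_ [v [C1 [C2 [[/andP[cC1 /eqP wC1] /andP[cC2 /eqP wC2]] nC [vC1 vC2] CI]]]]].
have adjC (C : {set G}) x : clique C -> v \in C -> x \in C -> x != v -> adj v x.
  move=> cC vC xC nxv.
  move/forall_inP: cC => /(_ v vC)/forall_inP/(_ x xC)/implyP; apply.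
  by rewrite eq_sym.
rewrite ltnNge; apply/negP => le_chi.
have /existsP[f /andP[fP /forallP/(_ v)/implyP fCF]] := pcf_colorable_chi G.
(* An isolated [v] would make both cliques equal to the singleton of [v], but they are distinct. *)
have v_nonisolated : nbh v != finset.set0.
  apply/eqP => nv0.
  have single (C : {set G}) : clique C -> v \in C -> C = [set v]%SET.
    move=> cC vC; apply/setP => x; rewrite inE.
    apply/idP/eqP => [xC|->//]; apply/eqP; apply: contraT => nxv.
    by have : x \in nbh v; [rewrite inE (adjC C)|rewrite nv0 inE].
  by apply: nC; rewrite (single C1)// (single C2).
have /existsP[c /cards1P[z zE]] := fCF v_nonisolated.
have nv_c : f v != c.
  have : z \in [set u in nbh v | f u == c]%SET by rewrite zE inE.
  rewrite !inE => /andP[vz /eqP <-].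
  by move/forallP: fP => /(_ v)/forallP/(_ z)/implyP; apply.
(* A maximum clique through [v] has a vertex of color [c]; it is a neighbor of [v], hence the unique
   one, [z]. So [z] lies in both cliques and equals [v], a contradiction. *)
have in_z (C : {set G}) : clique C -> #|C| = omega G -> v \in C -> z \in C.
  move=> cC wC vC.
  have [x xC fx] : exists2 x, x \in C & f x = c.
    by apply: proper_coloring_clique_onto; rewrite ?wC.
  have nxv : x != v by apply: contraNneq nv_c => <-; rewrite fx.
  have : x \in [set u in nbh v | f u == c]%SET by rewrite !inE (adjC C)// fx /=.
  by rewrite zE inE => /eqP <-.
have : z \in C1 :&: C2 by rewrite inE !in_z.
rewrite CI inE => /eqP zv.
have : z \in [set u in nbh v | f u == c]%SET by rewrite zE inE.
by rewrite zv !inE adj_irrefl.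
Qed.

Theorem theorem7 (R : realType) (G : sgraph)
  (hconn : connected_graph G) (hG : proper_interval_graph R G) :
  chi_pcf G <= omega G + 1 /\
  (chi_pcf G = omega G + 1 <-> special_proper_interval_graph R G).
Proof.
have [p hp] := proper_interval_umbrella hG.
have chi_le : chi_pcf G <= omega G + 1.
  by rewrite addn1; apply: chi_pcf_leq; exact: pcf_colorable_omegaS hp.
split=> //; split=> [chiE|/special_chi_pcf_gt]; last by lia.
apply: special_of_not_colorable => //.
by apply/negP => /chi_pcf_leq; rewrite chiE addn1 ltnn.
Qed.
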